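(* Let $\mathcal{H}=(V,E)$ be a loopless hypergraph such that $\mathrm{ar}(\mathcal{H})\ge\sqrt{\Delta([\mathcal{H}]_2)+1}$. Then $\mathrm{q}(\mathcal{H})\le\Delta([\mathcal{H}]_2)+1$.
   Context: A hypergraph $\mathcal{H}=(V,E)$ consists of a finite nonempty set $V$ of vertices and a nonempty set $E$ of nonempty subsets of $V$, called hyperedges. It is not assumed to be linear, i.e. two distinct hyperedges may share more than one vertex. A loop is a hyperedge $e$ with $|e|=1$; $\mathcal{H}$ is loopless if it has no loop. The antirank of $\mathcal{H}$ is $\mathrm{ar}(\mathcal{H})=\min_{e\in E}|e|$. The 2-section of $\mathcal{H}$ is the loopless multigraph $[\mathcal{H}]_2$ with vertex set $V$ in which two distinct vertices $x,y$ are joined by exactly $m$ parallel edges, where $m$ is the number of hyperedges of $\mathcal{H}$ containing both $x$ and $y$. $\Delta([\mathcal{H}]_2)$ denotes the maximum degree of this multigraph, with edges counted with multiplicity; thus the degree of $x$ in $[\mathcal{H}]_2$ is $\sum_{e\in E,\ x\in e}(|e|-1)$. The chromatic index $\mathrm{q}(\mathcal{H})$ is the least integer $q$ such that there exists a map $c:E\to\{1,2,\dots,q\}$ satisfying: for all $e,e'\in E$, $c(e)=c(e')$ implies $e\cap e'=\varnothing$ or $e=e'$. *)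

(* Defs.v *)
From HB Require Import structures.
From mathcomp Require Import all_boot all_order all_algebra.

Set Implicit Arguments.
Unset Strict Implicit.
Unset Printing Implicit Defensive.

(* The vertex set is the whole finite type V; it is nonempty because there is
   a hyperedge and hyperedges are nonempty. *)
Record hypergraph (V : finType) := Hypergraph {
  edges : {set {set V}};
  edges_neq0 : edges != set0;
  edge_neq0 : forall e : {set V}, e \in edges -> e != set0 }.

Definition loopless (V : finType) (H : hypergraph V) : Prop :=
  forall e : {set V}, e \in edges H -> #|e| != 1.

Lemma exists_edge_card (V : finType) (H : hypergraph V) :
  exists k, [exists e in edges H, #|e| == k].
Proof.
have /set0Pn[e He] := edges_neq0 H.
by exists #|e|; apply/existsP; exists e; rewrite He eqxx.
Qed.

Definition antirank (V : finType) (H : hypergraph V) : nat :=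
  ex_minn (exists_edge_card H).

(* A loopless multigraph on V: mult x y is the number of parallel edges
   joining x and y. *)
Record multigraph (V : finType) := Multigraph {
  mult : V -> V -> nat;
  mult_sym : forall x y, mult x y = mult y x;
  mult_irr : forall x, mult x x = 0 }.

Definition degree (V : finType) (G : multigraph V) (x : V) : nat :=
  \sum_(y : V) mult G x y.

Definition max_degree (V : finType) (G : multigraph V) : nat :=
  \max_(x : V) degree G x.

Definition section2_mult (V : finType) (H : hypergraph V) (x y : V) : nat :=
  if x == y then 0 else #|[set e in edges H | (x \in e) && (y \in e)]|.

Lemma section2_mult_sym (V : finType) (H : hypergraph V) (x y : V) :
  section2_mult H x y = section2_mult H y x.
Proof.
rewrite /section2_mult eq_sym; case: eqP => // _.
by apply: eq_card => e; rewrite !inE [(x \in e) && _]andbC.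
Qed.

Lemma section2_mult_irr (V : finType) (H : hypergraph V) (x : V) :
  section2_mult H x x = 0.
Proof. by rewrite /section2_mult eqxx. Qed.

Definition section2 (V : finType) (H : hypergraph V) : multigraph V :=
  Multigraph (section2_mult_sym H) (section2_mult_irr H).

Lemma degree_section2 (V : finType) (H : hypergraph V) (x : V) :
  degree (section2 H) x = \sum_(e in edges H | x \in e) (#|e| - 1).
Proof.
rewrite /degree /= (bigD1 x) //= section2_mult_irr add0n.
transitivity (\sum_(y | y != x) \sum_(e in edges H | x \in e) (y \in e : nat)).
  apply: eq_bigr => y /negPf yx; rewrite /section2_mult eq_sym yx -sum1_card.
  rewrite -big_mkcondr; apply: eq_bigl => e; rewrite !inE andbA.
  by [].
rewrite exchange_big; apply: eq_bigr => e /andP[_ xe].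
rewrite (cardsD1 x e) xe addKn -big_mkcondr -sum1_card.
by apply: eq_bigl => y; rewrite !inE.
Qed.

(* The colours 1, ..., q are represented by the q elements of 'I_q. *)
Definition edge_colorable (V : finType) (H : hypergraph V) (q : nat) : bool :=
  [exists c : {ffun {e : {set V} | e \in edges H} -> 'I_q},
    forall e, forall e',
      (c e == c e') ==> (val e :&: val e' == set0) || (e == e')].

Lemma exists_edge_colorable (V : finType) (H : hypergraph V) :
  exists q, edge_colorable H q.
Proof.
exists #|{: {e : {set V} | e \in edges H}}|; apply/existsP.
exists [ffun e => enum_rank e]; apply/forallP => e; apply/forallP => e'.
by rewrite !ffunE (inj_eq enum_rank_inj); case: eqP => //=; rewrite orbT.
Qed.

Definition chromatic_index (V : finType) (H : hypergraph V) : nat :=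
  ex_minn (exists_edge_colorable H).

(* Main.v *)
(** Let D be the maximum degree of the 2-section and S a minimal set of
    hyperedges that is not (D+1)-colourable. Every hyperedge of S meets at least
    D+1 others in S. Double counting around a smallest hyperedge e of S forces
    equality everywhere: D+1 = |e|^2, e meets exactly |e|^2 others, each in one
    vertex and each of size |e|, and every vertex of e has degree |e|+1. By
    minimality all of S is like that, and it remains to exclude this tight case
    of Brooks' theorem.

    Uncolour one vertex v of the critical intersection graph. Its neighbours
    then carry each colour exactly once, so the hole can be slid to any
    neighbour. Sliding it around an induced cycle v, w, u, ..., z shows that u
    and z have the same colour. But w and u have a common neighbour x, and
    sliding the hole v, w, u, x, w, v swaps the colours of u and x only, a
    contradiction. Finally, an induced path that cannot be prolonged yields an
    induced cycle of length at least 4, since no two adjacent hyperedges e, f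
    have N(e) included in N[f]: the |e|+1 hyperedges through a vertex outside f
    would meet f in distinct vertices. *)

Require Import Defs.
From mathcomp Require Import all_boot all_order all_algebra.
From mathcomp Require Import zify.

Set Implicit Arguments.
Unset Strict Implicit.
Unset Printing Implicit Defensive.

Import Order.TTheory GRing.Theory Num.Theory.

(** * Colour-critical graphs with a hole: the tight case of Brooks' theorem *)

Section CriticalGraphs.
Context (T C : finType) (adj : rel T).
Hypotheses (adj_sym : symmetric adj) (adj_irr : irreflexive adj).
Implicit Types (S : {set T}) (c : T -> C).

Definition proper_on S c := {in S &, forall x y, adj x y -> c x != c y}.

Definition colorable_on S :=
  [exists c : {ffun T -> C},
    [forall x in S, forall y in S, adj x y ==> (c x != c y)]].

Definition nbr S x := [set y in S | adj x y].

Lemma colorable_onP S :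
  reflect (exists c : T -> C, proper_on S c) (colorable_on S).
Proof.
apply: (iffP existsP) => [[c cP] | [c cP]].
  exists c => x y xS yS xy.
  by move/forall_inP/(_ x xS)/forall_inP/(_ y yS)/implyP: cP; apply.
exists [ffun x => c x]; apply/forall_inP => x xS; apply/forall_inP => y yS.
by apply/implyP => xy; rewrite !ffunE cP.
Qed.

Lemma proper_on_recolor S c v a :
    proper_on (S :\ v) c -> {in nbr S v, forall y, c y != a} ->
  proper_on S [eta c with v |-> a].
Proof.
move=> cP ca x y xS yS /=.
case: (eqVneq x v) => [->|xv]; case: (eqVneq y v) => [->|yv].
- by rewrite adj_irr.
- by move=> vy; rewrite eq_sym ca // inE yS.
- by move=> xv'; rewrite ca // inE xS adj_sym.
- by apply: cP; rewrite !inE ?xv ?yv.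
Qed.

Lemma colorable_on_split S (A : {set T}) :
    {in A & S :\: A, forall x y, ~~ adj x y} ->
  colorable_on A -> colorable_on (S :\: A) -> colorable_on S.
Proof.
move=> sepA /colorable_onP[c cP] /colorable_onP[c' c'P].
apply/colorable_onP.
exists (fun x => if x \in A then c x else c' x) => x y xS yS.
case: ifP => xA; case: ifP => yA xy; first exact: cP.
- by have := sepA x y xA; rewrite !inE yA yS xy => /(_ isT).
- by have := sepA y x yA; rewrite !inE xA xS adj_sym xy => /(_ isT).
- by apply: c'P; rewrite // !inE ?xA ?yA.
Qed.

Section Uncolorable.
Context (S : {set T}).
Hypothesis S_uncol : ~~ colorable_on S.

(** If [a] were missing around the hole [v], then [v] could take it and [S] would be coloured. *)
Lemma hole_surj c v a :
  proper_on (S :\ v) c -> exists2 y, y \in nbr S v & c y = a.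
Proof.
move=> cP; case: (boolP [exists y in nbr S v, c y == a]).
  by case/exists_inP => y yN /eqP; exists y.
move/exists_inPn => ca; case/colorable_onP: S_uncol.
by exists [eta c with v |-> a]; apply: proper_on_recolor.
Qed.

Lemma hole_imset c v : proper_on (S :\ v) c -> c @: nbr S v = setT.
Proof.
move=> cP; apply/setP => a; rewrite inE; apply/imsetP.
by have [y yN <-] := hole_surj a cP; exists y.
Qed.

Hypothesis S_deg : {in S, forall x, #|nbr S x| <= #|C|}.

(** At most [#|C|] neighbours already show all [#|C|] colours, so none is repeated. *)
Lemma hole_inj c v :
  v \in S -> proper_on (S :\ v) c -> {in nbr S v &, injective c}.
Proof.
move=> vS cP; apply/imset_injP; rewrite eqn_leq leq_imset_card.
by rewrite (hole_imset cP) cardsT S_deg.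
Qed.

(** By [hole_inj], [w] is the only neighbour of [v] with its colour, so [v] can take that colour
    once [w] gives it up. *)
Lemma hole_move c v w : v \in S -> w \in S -> adj v w ->
  proper_on (S :\ v) c -> proper_on (S :\ w) [eta c with v |-> c w].
Proof.
move=> vS wS vw cP; apply: proper_on_recolor.
  by apply: sub_in2 cP => x; rewrite !inE => /and3P[-> _ ->].
move=> y; rewrite !inE => /andP[/andP[yw yS] vy].
by apply: contraNneq yw => /(hole_inj vS cP) -> //; rewrite inE ?yS ?wS.
Qed.

(* Slides the uncoloured vertex from v along p: each vertex on the way takes
   the colour of its successor. *)
Fixpoint push c v p :=
  if p is w :: p' then push [eta c with v |-> c w] w p' else c.

Lemma proper_push c v p : path adj v p -> {subset v :: p <= S} ->
  proper_on (S :\ v) c -> proper_on (S :\ last v p) (push c v p).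
Proof.
elim: p c v => //= w p IHp c v /andP[vw wp] sub cP.
have [vS wS]: v \in S /\ w \in S by split; apply: sub; rewrite !inE eqxx ?orbT.
apply: IHp => //; first by move=> x xp; apply: sub; rewrite inE xp orbT.
exact: hole_move.
Qed.

Lemma push_out c v p x : x \notin belast v p -> push c v p x = c x.
Proof.
elim: p c v => //= w p IHp c v; rewrite inE negb_or => /andP[/negPf xv xp].
by rewrite IHp //= xv.
Qed.

Lemma push_rcons c v p w :
  push c v (rcons p w) = [eta push c v p with last v p |-> push c v p w].
Proof. by elim: p c v => /=. Qed.

(* Sliding the hole v once around the cycle puts the colours of u and w at the
   cycle neighbours w and z of v, which had the colours of w and z. *)
Lemma cycle_color c v w u p :
    proper_on (S :\ v) c -> {subset [:: v, w, u & p] <= S} ->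
    path adj v [:: w, u & p] -> uniq [:: v, w, u & p] ->
    adj v (last u p) ->
    {in u :: p, forall y, adj v y -> y = last u p} ->
  c u = c (last u p).
Proof.
set z := last u p => cP sub vp.
rewrite cons_uniq => /andP[vnp /= /andP[wnp unp]] vz Nv.
have vS : v \in S by apply: sub; rewrite inE eqxx.
have wS : w \in S by apply: sub; rewrite !inE eqxx orbT.
have zup : z \in u :: p by apply: mem_last.
have zS : z \in S by apply: sub; rewrite 2!inE zup !orbT.
have vw : adj v w by case/andP: vp.
have vcyc : path adj v (rcons [:: w, u & p] v).
  by rewrite rcons_path vp /= adj_sym.
have subcyc : {subset v :: rcons [:: w, u & p] v <= S}.
  by move=> x; rewrite inE mem_rcons inE orbA orbb; apply: sub.
have := proper_push vcyc subcyc cP; rewrite last_rcons.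
set c' := push _ _ _ => c'P.
have c'E x : c' x = if x == z then push c v [:: w, u & p] v
                    else push c v [:: w, u & p] x by rewrite /c' push_rcons.
(* The colour [c z] still occurs around [v]. It is neither at [z], which now has the colour of [w],
   nor at an untouched neighbour, since [c] is injective around [v]. So it is at [w], which took the
   colour of [u]. *)
have [y] := hole_surj (c z) c'P; rewrite inE => /andP[yS vy].
have wz : w != z by apply: contraNneq wnp => ->.
rewrite c'E; have [_ | yz] := eqVneq y z.
  have vw' : v == w = false by apply/eqP => E; rewrite -E adj_irr in vw.
  rewrite /= push_out /= ?vw' ?eqxx; last first.
    by apply: contra vnp => /mem_belast vup; rewrite inE vup orbT.
  move=> /(hole_inj vS cP) E; move: wz; rewrite E ?eqxx //.
    by rewrite inE wS.
  by rewrite inE zS.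
have [->|yw] := eqVneq y w.
  have uv : u == v = false.
    by apply/eqP => E; move: vnp; rewrite -E !inE eqxx orbT.
  have wv : w == v = false.
    by apply/eqP => E; move: vnp; rewrite -E !inE eqxx.
  rewrite /= push_out /=; first by rewrite eqxx uv.
  by apply: contra wnp => /mem_belast.
have ynp : y \notin u :: p by apply: contra yz => yp; rewrite (Nv y).
rewrite push_out.
  move/(hole_inj vS cP) => E; move: yz; rewrite E ?eqxx //.
    by rewrite inE yS.
  by rewrite inE zS.
have yv : y != v by apply: contraTneq vy => ->; rewrite adj_irr.
by apply: contra ynp => /mem_belast; rewrite !inE (negPf yv) (negPf yw).
Qed.

(** [cycle_color] applies both before and after the walk v, w, u, x, w, v of the hole. The far end
    [last u p] differs from [u], hence lies off the walk and keeps its colour; so [u] and [x] both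
    had that colour although they are adjacent. *)
Lemma no_induced_cycle c v w u p x :
    proper_on (S :\ v) c -> {subset [:: v, w, u & p] <= S} ->
    path adj v [:: w, u & p] -> uniq [:: v, w, u & p] ->
    adj v (last u p) -> u != last u p ->
    {in u :: p, forall y, adj v y -> y = last u p} ->
    x \in S -> adj w x -> adj u x -> x \notin [:: v, w, u & p] ->
  False.
Proof.
move=> cP sub vp Up vz uz Nv xS wx ux; set z := last u p in vz uz Nv *.
rewrite !inE !negb_or => /and4P[xv xw xu xp].
have [vS wS uS] : [/\ v \in S, w \in S & u \in S].
  by split; apply: sub; rewrite !inE eqxx ?orbT.
have [vw wu _] := and3P vp.
have := Up; rewrite /= !inE !negb_or.
move=> /and4P[/and3P[vw' vu vp'] /andP[wu' wp] up _].
have zx : z != x.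
  apply: contraNneq xp => zx; have := mem_last u p.
  by rewrite -/z zx inE (negPf xu).
have zv : z != v by apply: contraTneq vz => ->; rewrite adj_irr.
have zw : z != w.
  have := mem_last u p; rewrite -/z inE eq_sym (negPf uz) /=.
  by apply: contraTneq => ->.
have c'P : proper_on (S :\ v) (push c v [:: w; u; x; w; v]).
  apply: (@proper_push c v [:: w; u; x; w; v]) => //.
    by rewrite /= vw wu ux adj_sym wx adj_sym vw.
  by move=> y; rewrite !inE; do 5?[case/predU1P => [->//|]]; move/eqP->.
have := cycle_color c'P sub vp Up vz Nv.
have cuz := cycle_color cP sub vp Up vz Nv; rewrite -/z in cuz *.
rewrite [RHS]push_out /=; last first.
  by rewrite !inE !negb_or zv zw [z == u]eq_sym uz zx.
rewrite !(eqxx, negPf xv, negPf xw, negPf xu, negPf vu, negPf wu', negPf vw').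
rewrite [u == v]eq_sym [u == w]eq_sym [u == x]eq_sym.
rewrite !(eqxx, negPf xv, negPf xw, negPf xu, negPf vu, negPf wu', negPf vw').
rewrite -cuz => E; have := cP u x; rewrite !inE [u == v]eq_sym vu xv uS xS.
by rewrite E eqxx => /(_ isT isT ux).
Qed.

(** Induced paths, with the growing end at the head so that prolonging is a cons. *)
Fixpoint induced s :=
  if s is x :: s' then
    [&& x \notin s',
        if s' is y :: s'' then adj x y && ~~ has (adj x) s'' else true &
        induced s']
  else true.

Lemma induced_uniq s : induced s -> uniq s.
Proof. by elim: s => //= x s IHs /and3P[-> _ /IHs]. Qed.

Lemma induced_path x s : induced (x :: s) -> path adj x s.
Proof.
elim: s x => //= y s IHs x /and3P[_ /andP[-> _]] ys.
exact: IHs.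
Qed.

Hypothesis S_min : {in S, forall v, colorable_on (S :\ v)}.
Hypothesis common_nbr : {in S &, forall x y, adj x y ->
  exists2 z, z \in S & adj x z && adj y z}.
Hypothesis no_twins : {in S &, forall x y, adj x y ->
  exists2 z, z \in S & [&& adj x z, z != y & ~~ adj y z]}.

(* A neighbour w of x outside N[y] prolongs the path: otherwise its first
   neighbour further along the path closes an induced cycle. *)
Lemma induced_extend x y s : {subset [:: x, y & s] <= S} ->
    induced [:: x, y & s] ->
  exists2 w, w \in S & induced [:: w, x, y & s].
Proof.
move=> sub ind; have := ind.
rewrite [induced _]/= => /and3P[xnp /andP[xy xs] ind'].
have xS : x \in S by apply: sub; rewrite inE eqxx.
have yS : y \in S by apply: sub; rewrite !inE eqxx orbT.
have [w wS /and3P[xw wy yw]] := no_twins xS yS xy.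
have ws : w \notin s by apply: contra xs => ws; apply/hasP; exists w.
have wx : w != x by apply: contraTneq xw => ->; rewrite adj_irr.
have wxys : w \notin [:: x, y & s] by rewrite !inE !negb_or wx wy.
case: (boolP (has (adj w) s)) => [hs | nhs]; last first.
  exists w => //; move: ind.
  by rewrite /= [adj w x]adj_sym xw [adj w y]adj_sym (negPf yw) nhs wxys.
have [t tS /andP[xt yt]] := common_nbr xS yS xy.
have [c cP] := colorable_onP _ (S_min wS).
move: sub ind xs ws wxys xnp.
case: (split_find hs) => z s1 s2 wz s1w sub ind xs ws wxys xnp.
(* Here [z] is the first neighbour of [w] along [s]; the hole is at [w], and [t] is the common
   neighbour of [x] and [y]. *)
exfalso; apply: (@no_induced_cycle c w x y (rcons s1 z) t) => //.
- move=> r; rewrite inE => /predU1P[->//|rs]; apply: sub.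
  by move: rs; rewrite !inE mem_cat => /or3P[->|->|->]; rewrite ?orbT.
- have := induced_path ind; rewrite /= [adj w x]adj_sym xw cat_path.
  by case/and3P => -> ->.
- have := induced_uniq ind; rewrite -!cat_cons cat_uniq => /andP[Us1 _].
  rewrite cons_uniq Us1 andbT.
  by move: wxys; rewrite -!cat_cons mem_cat negb_or => /andP[].
- by rewrite last_rcons.
- by rewrite last_rcons; apply: contraTneq wz => <-; rewrite adj_sym.
- rewrite last_rcons => r; rewrite inE mem_rcons inE.
  case/or3P => [/eqP->|/eqP->|rs1] //.
    by rewrite adj_sym (negPf yw).
  by move=> wr; case/hasP: s1w; exists r.
- rewrite !inE !negb_or; apply/and4P; split.
  + by apply: contraTneq yt => ->.
  + by apply: contraTneq xt => ->; rewrite adj_irr.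
  + by apply: contraTneq yt => ->; rewrite adj_irr.
  + by apply: contra xs => ts; apply/hasP; exists t; rewrite // mem_cat ts.
Qed.

(** An edge is an induced path; prolonged again and again it would outgrow the finite type [T]. *)
Lemma critical_edgeless : {in S &, forall x y, ~~ adj x y}.
Proof.
move=> x y xS yS; apply/negP => xy.
suff ex n : exists s a b, [/\ size s = n, {subset [:: a, b & s] <= S} &
                              induced [:: a, b & s]].
  have [s [a [b [sz _ /induced_uniq/card_uniqP E]]]] := ex #|T|.
  by have := max_card [in [:: a, b & s]]; rewrite E /= sz ltnNge leqnSn.
elim: n => [|n [s [a [b [sz sub ind]]]]].
  exists [::], x, y; split=> // [z|]; first by rewrite !inE => /orP[]/eqP->.
  rewrite /= inE xy !andbT.
  by apply: contraTneq xy => ->; rewrite adj_irr.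
have [w wS wind] := induced_extend sub ind.
exists (b :: s), w, a; split=> //=; first by rewrite sz.
by move=> z; rewrite inE => /predU1P[->//|]; apply: sub.
Qed.

End Uncolorable.

End CriticalGraphs.

(** * Arithmetic of the equality case *)

Lemma eq_sum_pointwise (I : finType) (P : pred I) (E1 E2 : I -> nat) :
    (forall i, P i -> E1 i <= E2 i) ->
    \sum_(i | P i) E2 i <= \sum_(i | P i) E1 i ->
  forall i, P i -> E1 i = E2 i.
Proof.
move=> le12 ge12 i Pi; apply/eqP; rewrite eqn_leq le12 //=.
move: ge12; rewrite (bigD1 i) // [leqRHS](bigD1 i) //=.
have : \sum_(j | P j && (j != i)) E1 j <= \sum_(j | P j && (j != i)) E2 j.
  by apply: leq_sum => j /andP[/le12].
lia.
Qed.

(** Put t = s - 1 and r = D - t. The two bounds on [W] give (t + r + 1) t <= (t + 1) r, that is t (t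
    + 1) <= r, while [D + 1 <= s ^ 2] gives the reverse inequality. *)
Lemma extremal_arith s D N W : 1 < s -> s - 1 <= D -> D + 1 <= s ^ 2 ->
    D + 1 <= N -> N * (s - 1) <= W -> W <= s * (D - (s - 1)) ->
  [/\ D + 1 = s ^ 2, N = s ^ 2, D - (s - 1) = s * (s - 1) & W = N * (s - 1)].
Proof.
case: s => [//|t]; rewrite subn1 /= => t_gt0 /subnKC; set r := D - t.
move=> <- rt DN lo hi.
have le1 : (t + r + 1) * t <= t.+1 * r.
  by apply: leq_trans hi; apply: leq_trans lo; rewrite leq_mul2r DN orbT.
have rE : r = t.+1 * t by lia.
have le2 : N * t <= t.+1 ^ 2 * t.
  by apply: leq_trans lo _; apply: leq_trans hi _; rewrite rE mulnA.
rewrite leq_pmul2r // in le2.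
have NE : N = t.+1 ^ 2 by lia.
split=> //; first by lia.
apply/eqP; rewrite eqn_leq lo andbT; apply: leq_trans hi _.
by rewrite NE rE mulnA.
Qed.

Lemma mul_eq_min s f c : 1 < s -> s <= f -> 0 < c ->
  c * (f - 1) = s - 1 -> f = s /\ c = 1.
Proof.
case: c => [//|[|c]] s_gt1 sf _ E; first by lia.
have : 2 * (f - 1) <= c.+2 * (f - 1) by rewrite leq_mul2r orbT.
lia.
Qed.

(** * Intersection graphs of hypergraphs and the double count around a smallest hyperedge *)

Section Hypergraphs.
Context (V : finType).
Implicit Types (S : {set {set V}}) (e f : {set V}).

Definition meets e f := (e != f) && (e :&: f != set0).

Lemma meets_sym : symmetric meets.
Proof. by move=> e f; rewrite /meets eq_sym setIC. Qed.

Lemma meets_irr : irreflexive meets.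
Proof. by move=> e; rewrite /meets eqxx. Qed.

Lemma meetsI e f x : x \in e -> x \in f -> e != f -> meets e f.
Proof.
by move=> xe xf ef; rewrite /meets ef; apply/set0Pn; exists x; rewrite inE xe.
Qed.

Lemma edge_colorable_on (H : hypergraph V) q :
  colorable_on 'I_q meets (edges H) -> edge_colorable H q.
Proof.
case/colorable_onP => c cP; apply/existsP; exists [ffun e => c (val e)].
apply/forallP => e; apply/forallP => f; rewrite !ffunE.
apply/implyP => /eqP cef.
rewrite -val_eqE; apply: contraT; rewrite negb_or => /andP[ef0 ef].
by have := cP _ _ (valP e) (valP f); rewrite cef eqxx; apply; rewrite /meets ef.
Qed.

Definition star S (x : V) := [set f in S | x \in f].

Section ExtremalEdge.
Context (S : {set {set V}}) (D : nat) (e : {set V}).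
Hypothesis star_le : forall x, \sum_(f in S | x \in f) (#|f| - 1) <= D.
Hypotheses (eS : e \in S) (e_gt1 : 1 < #|e|).
Hypothesis e_min : {in S, forall f, #|e| <= #|f|}.
Hypothesis De : D + 1 <= #|e| ^ 2.
Hypothesis nbr_gt : D + 1 <= #|nbr meets S e|.

(** The hyperedges of [S] through [x] are [e], contributing [#|e| - 1], and neighbours of [e]. *)
Lemma sum_star_nbr x : x \in e ->
  \sum_(f in nbr meets S e | x \in f) (#|f| - 1) + (#|e| - 1) <= D.
Proof.
move=> xe; apply: leq_trans (star_le x); rewrite addnC.
rewrite [leqRHS](bigD1 e) ?eS //= leq_add2l.
apply/eq_leq/eq_bigl => f; rewrite !inE eq_sym.
case: (boolP (x \in f)) => [xf|]; last by rewrite !andbF.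
have [->|fe] := eqVneq e f; first by rewrite meets_irr !andbF.
by rewrite (meetsI xe xf).
Qed.

Lemma sum_nbr_cap : \sum_(f in nbr meets S e) #|e :&: f| * (#|f| - 1) =
  \sum_(x in e) \sum_(f in nbr meets S e | x \in f) (#|f| - 1).
Proof.
rewrite (exchange_big_dep (mem (nbr meets S e))) => /= [|x f _ /andP[]//].
apply: eq_bigr => f fN; rewrite sum_nat_cond_const; congr (_ * _).
by apply: eq_card => x; rewrite !inE; move: fN; rewrite !inE => ->.
Qed.

Lemma nbr_term_ge f : f \in nbr meets S e ->
  #|e| - 1 <= #|e :&: f| * (#|f| - 1).
Proof.
rewrite inE => /andP[fS /andP[_]]; rewrite -card_gt0 => ef.
by have := e_min fS; nia.
Qed.

(* Equality throughout
   (|e|-1)(D+1) <= \sum_(f in nbr e) |e & f| (|f|-1) <= |e| (D+1-|e|),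
   which already forces |e|^2 <= D + 1. *)
Lemma extremal_edge :
  [/\ D + 1 = #|e| ^ 2, #|nbr meets S e| = #|e| ^ 2,
      {in nbr meets S e, forall f, #|f| = #|e| /\ #|e :&: f| = 1} &
      {in e, forall x, #|star S x| = #|e|.+1}].
Proof.
set N := nbr meets S e; set s := #|e|.
have N_gt : D + 1 <= #|N| := nbr_gt.
have s_gt1 : 1 < s := e_gt1.
have Ds2 : D + 1 <= s ^ 2 := De.
set Sg := \sum_(f in N) #|e :&: f| * (#|f| - 1).
have lo : \sum_(f in N) (s - 1) <= Sg by apply: leq_sum; apply: nbr_term_ge.
have hi : Sg <= \sum_(x in e) (D - (s - 1)).
  rewrite /Sg sum_nbr_cap; apply: leq_sum => x /sum_star_nbr; lia.
(* This makes the truncated subtraction [D - (s - 1)] exact. *)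
have Ds : s - 1 <= D.
  have [x xe] : exists x, x \in e by apply/card_gt0P; lia.
  by have := sum_star_nbr xe; lia.
rewrite !sum_nat_const -/s in lo hi.
have [DE NE rE SgE] := extremal_arith s_gt1 Ds Ds2 N_gt lo hi.
have term f : f \in N -> #|e :&: f| * (#|f| - 1) = s - 1.
  move=> fN; apply/esym; move: f fN; apply: eq_sum_pointwise => [f|].
    exact: nbr_term_ge.
  by rewrite sum_nat_const -/Sg SgE.
have Nf : {in N, forall f, #|f| = s /\ #|e :&: f| = 1}.
  move=> f fN; have := fN; rewrite inE => /andP[fS /andP[_ ef]].
  by apply: (mul_eq_min s_gt1 (e_min fS)); rewrite ?card_gt0 ?term.
split=> // x xe.
have starE : star S x = e |: [set f in N | x \in f].
  apply/setP => f; rewrite !inE.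
  have [->|fe] := eqVneq f e; first by rewrite eS.
  case: (boolP (x \in f)) => [xf|]; last by rewrite !andbF.
  by rewrite eq_sym in fe; rewrite (meetsI xe xf fe) !andbT.
rewrite starE cardsU1 !inE meets_irr !andbF add1n; congr _.+1.
have cE : \sum_(f in N | x \in f) (#|f| - 1)
    = #|[set f in N | x \in f]| * (s - 1).
  rewrite -sum_nat_const; apply: eq_big => [f|f /andP[/Nf[-> _] _]//].
  by rewrite inE.
(* Each vertex of [e] has at most this sum and the totals agree, so equality holds at every vertex;
   dividing s (s - 1) by s - 1 leaves s neighbours of [e] through [x]. *)
have : \sum_(f in N | x \in f) (#|f| - 1) = D - (s - 1).
  move: x xe {starE cE}; apply: eq_sum_pointwise => [x /sum_star_nbr /=|].
    by rewrite -/N -/s; lia.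
  by rewrite sum_nat_const -/s -sum_nbr_cap -/N -/Sg SgE NE rE -mulnn mulnA.
by rewrite cE rE => /eqP; rewrite eqn_pmul2r ?subn_gt0 // => /eqP.
Qed.

End ExtremalEdge.

(** * Excluding the tight case and reducing to it *)

Lemma uniform_noncritical S s : 1 < s -> {in S, forall e, #|e| = s} ->
    {in S, forall e, #|nbr meets S e| = s ^ 2} ->
    {in S, forall e f, f \in nbr meets S e -> #|e :&: f| = 1} ->
    {in S, forall e x, x \in e -> #|star S x| = s.+1} ->
    {in S, forall e, colorable_on 'I_(s ^ 2) meets (S :\ e)} ->
  colorable_on 'I_(s ^ 2) meets S.
Proof.
move=> s_gt1 card_S nbrS capS starS crit; apply: contraT => uncol.
have nbrI e f : e \in S -> f \in S -> meets e f -> #|e :&: f| = 1.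
  by move=> eS fS ef; apply: capS; rewrite // inE fS.
have S_edgeless : {in S &, forall e f, ~~ meets e f}.
  apply: (critical_edgeless meets_sym meets_irr uncol _ crit).
  - by move=> e /nbrS->; rewrite card_ord.
  - move=> e f eS fS ef; have /andP[ne /set0Pn[x /setIP[xe xf]]] := ef.
    (* Since s + 1 >= 3, a third hyperedge passes through the common vertex [x]. *)
    have : 0 < #|star S x :\ e :\ f|.
      have := starS e eS x xe.
      rewrite (cardsD1 e) (cardsD1 f (_ :\ _)) !inE eS xe fS xf.
      by rewrite [f == e]eq_sym ne !add1n => -[E]; rewrite -ltnS E.
    case/card_gt0P => z; rewrite !inE => /and4P[zf ze zS xz].
    by exists z; rewrite // (meetsI xe xz) 1?eq_sym // (meetsI xf xz) 1?eq_sym.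
  - move=> e f eS fS ef.
    have /subsetPn[x xe xf] : ~~ (e \subset f).
      apply/negP => /setIidPl E; have := nbrI _ _ eS fS ef.
      by rewrite E card_S // => s1; rewrite s1 in s_gt1.
    case: (boolP [exists z in S, [&& meets e z, z != f & ~~ meets f z]]).
      by case/exists_inP => z; exists z.
    move/exists_inPn => twins; exfalso.
    have star_f z : z \in star S x -> 1 <= #|z :&: f|.
      rewrite inE => /andP[zS xz]; rewrite card_gt0 setIC.
      have [<-|ez] := eqVneq e z; first by case/andP: ef; rewrite setIC.
      have zf : z != f by apply: contraNneq xf => <-.
      have := twins z zS; rewrite (meetsI xe xz ez) zf negbK.
      by case/andP.
    (* If all hyperedges through [x] meet [f], count them by a vertex of [f] they contain. No vertex
       [y] of [f] serves two of them, as these would share both [x] and [y]. Hence s + 1 <= s. *)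
    have : \sum_(z in star S x) 1 <= \sum_(y in f) 1.
      apply: (@leq_trans (\sum_(z in star S x) #|z :&: f|)).
        exact: leq_sum.
      rewrite (eq_bigr (fun z : {set V} => \sum_(y in f | y \in z) 1));
        last first.
        move=> z _; rewrite sum1dep_card.
        by apply: eq_card => y; rewrite !inE andbC.
      rewrite (exchange_big_dep (mem f)) => /= [|z y _ /andP[]//].
      apply: leq_sum => y yf; rewrite sum1dep_card.
      have xy : x != y by apply: contraNneq xf => ->.
      apply/card_le1_eqP => z z'; rewrite !inE => /and3P[/andP[zS xz] _ yz].
      case/and3P => /andP[z'S xz'] _ yz'; apply: contraTeq isT => zz'.
      rewrite eq_sym in zz'.
      have := nbrI z z' zS z'S (meetsI xz xz' zz').
      have : #|[set x; y]| <= #|z :&: z'|.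
        apply/subset_leq_card/subsetP => t.
        by rewrite !inE => /orP[]/eqP->; rewrite ?xz ?yz.
      by rewrite cards2 xy => le2 E; rewrite E in le2.
    by rewrite !sum1_card (starS e) // card_S // ltnn.
case: (set_0Vmem S) => [S0|[e eS]].
  case/colorable_onP: uncol.
  have s2_gt0 : 0 < s ^ 2 by rewrite expn_gt0 ltnW.
  by exists (fun=> Ordinal s2_gt0) => x; rewrite S0 inE.
have : 0 < #|nbr meets S e| by rewrite nbrS // expn_gt0 ltnW.
case/card_gt0P => f; rewrite inE => /andP[fS].
by rewrite (negPf (S_edgeless _ _ eS fS)).
Qed.

Lemma critical_degree S (C : finType) e : ~~ colorable_on C meets S ->
  colorable_on C meets (S :\ e) -> #|C| <= #|nbr meets S e|.
Proof.
move=> uncol /colorable_onP[c cP].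
rewrite -cardsT -(hole_imset meets_sym meets_irr uncol cP).
exact: leq_imset_card.
Qed.

Lemma large_antirank_colorable S k D : 1 < k -> D + 1 <= k ^ 2 ->
    {in S, forall e, k <= #|e|} ->
    (forall x, \sum_(f in S | x \in f) (#|f| - 1) <= D) ->
  colorable_on 'I_(D + 1) meets S.
Proof.
move=> k_gt1 Dk kS star_le; apply: contraT => uncolS.
have [A /minsetP[uncol minA] AS] :=
  @minset_exists _ (fun B => ~~ colorable_on 'I_(D + 1) meets B) _ uncolS.
have subA (B : {set {set V}}) : B \subset A -> B != A ->
    colorable_on 'I_(D + 1) meets B.
  by move=> BA; apply: contraNT => /minA/(_ BA)->.
have crit : {in A, forall e, colorable_on 'I_(D + 1) meets (A :\ e)}.
  move=> e eA; apply: subA; first exact: subsetDl.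
  by apply: contraTneq eA => <-; rewrite !inE eqxx.
have star_leA x : \sum_(f in A | x \in f) (#|f| - 1) <= D.
  apply: leq_trans (star_le x).
  rewrite [leqRHS](bigID (mem A)) /= (eq_bigl (fun f : {set V} =>
    (f \in S) && (x \in f) && (f \in A))).
    exact: leq_addr.
  move=> f; case: (boolP (f \in A)) => [/(subsetP AS)->|].
    by rewrite andbT.
  by rewrite andbF.
have [e0 e0A] : exists e, e \in A.
  apply/set0Pn; apply: contra uncol => /eqP->.
  apply/colorable_onP; have D1 : 0 < D + 1 by rewrite addn1.
  by exists (fun=> Ordinal D1) => x; rewrite inE.
case: (arg_minnP (fun f : {set V} => #|f|) e0A) => e /= Ae e_min.
have eA : e \in A by [].
set s := #|e|.
have ks : k <= s by apply/kS/(subsetP AS).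
have s_gt1 : 1 < s by apply: leq_trans ks.
have Ds : D + 1 <= s ^ 2 by apply: leq_trans Dk _; rewrite leq_exp2r.
have ext f : f \in A -> #|f| = s ->
  [/\ D + 1 = s ^ 2, #|nbr meets A f| = s ^ 2,
      {in nbr meets A f, forall g : {set V}, #|g| = s /\ #|f :&: g| = 1} &
      {in f, forall x, #|star A x| = s.+1}].
  move=> fA fs; rewrite -fs; apply: extremal_edge; rewrite ?fs //.
  by rewrite -[leqLHS]card_ord critical_degree ?crit.
(* By [ext], hyperedges of size [s] meet only hyperedges of size [s]. So they form a union of
   components; were it proper, it and its complement could be coloured separately by minimality of
   [A]. *)
have unif f : f \in A -> #|f| = s.
  suff /setP/(_ f) : [set f in A | #|f| == s] = A.
    by rewrite !inE => + fA; rewrite fA => /eqP.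
  set B := [set _ in _ | _].
  have BA : B \subset A by apply/subsetP => g; rewrite inE => /andP[].
  apply/eqP; apply: contraT => nBA; case/negP: uncol.
  apply: (colorable_on_split meets_sym (A := B)); last 2 first.
  - exact: subA.
  - apply: subA; first exact: subsetDl.
    by apply/eqP => /setP/(_ e); rewrite !inE eA eqxx.
  move=> g h; rewrite !inE => /andP[gA /eqP gs] /andP[+ hA]; rewrite hA /=.
  apply: contra => gh; have [_ _ /(_ h)] := ext g gA gs.
  by rewrite inE hA gh => /(_ isT)[->].
have [DE _ _ _] := ext e eA erefl.
move: uncol crit; rewrite DE => uncol crit; case/negP: uncol.
apply: uniform_noncritical => // [f fA|f fA|f fA].
- by case: (ext f fA (unif f fA)).
- by move=> g gN; case: (ext f fA (unif f fA)) => _ _ /(_ g gN)[].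
- by case: (ext f fA (unif f fA)).
Qed.

End Hypergraphs.

(** * The bound on the chromatic index *)

Theorem theorem1 (R : rcfType) (V : finType) (H : hypergraph V)
    (Hloopless : loopless H)
    (Hantirank : (Num.sqrt ((max_degree (section2 H) + 1)%N%:R : R)
                    <= (antirank H)%:R)%R) :
  chromatic_index H <= max_degree (section2 H) + 1.
Proof.
have Dk : max_degree (section2 H) + 1 <= antirank H ^ 2.
  rewrite -(ler_nat R) natrX -[leLHS]sqr_sqrtr ?ler0n //.
  by rewrite lerXn2r ?nnegrE ?sqrtr_ge0 ?ler0n.
have k_min : {in edges H, forall e : {set V}, antirank H <= #|e|}.
  move=> e eH; rewrite /antirank; case: ex_minnP => k _; apply.
  by apply/existsP; exists e; rewrite eH eqxx.
(* The antirank is attained by a hyperedge, which is neither empty nor a loop. *)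
have k_gt1 : 1 < antirank H.
  rewrite /antirank; case: ex_minnP => k /existsP[e /andP[eH /eqP<-]] _.
  by rewrite ltn_neqAle eq_sym Hloopless // card_gt0 (edge_neq0 eH).
rewrite /chromatic_index; case: ex_minnP => q _; apply.
apply/edge_colorable_on/(large_antirank_colorable k_gt1 Dk k_min) => x.
rewrite -degree_section2; exact: (leq_bigmax x).
Qed.
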